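(* There exists an infinite subgroup $G$ of the compact group $\mathbb{Z}(2)^\omega$ such that $G$ is of the first category, $\mu(G)=0$, and every bounded subset of the dual group $G_p^\wedge$ is finite. In particular, $G_p^\wedge$ does not contain nontrivial convergent sequences.
   Context: $\mathbb{Z}(2)$ is the discrete two-element group, $\mathbb{Z}(2)^\omega$ is the countably infinite power with the product topology, and $\mu$ is the Haar (probability) measure on the compact group $\mathbb{Z}(2)^\omega$. The subgroup $G$ carries the subspace topology. A topological group is of the first category if it can be covered by countably many nowhere dense subsets (of itself). $\mathbb{T}$ is the circle group $\{z\in\mathbb{C}:|z|=1\}$ with its usual compact topology. For a topological abelian group $G$, $G_p^\wedge$ denotes the group of all continuous homomorphisms $G\to\mathbb{T}$ under pointwise multiplication, endowed with the topology of pointwise convergence on elements of $G$. A subset $B$ of a Tychonoff space $X$ is bounded in $X$ if $f(B)$ is a bounded subset of $\mathbb{R}$ for every continuous function $f\colon X\to\mathbb{R}$. A convergent sequence is nontrivial if it is not eventually constant. *)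

(* Defs.v *)
From HB Require Import structures.
From mathcomp Require Import all_boot all_order all_algebra.
From mathcomp Require Import complex.
From mathcomp Require Import all_classical all_reals all_analysis.

Set Implicit Arguments.
Unset Strict Implicit.
Unset Printing Implicit Defensive.

Import Order.TTheory GRing.Theory Num.Theory.
Import numFieldNormedType.Exports.

Local Open Scope classical_set_scope.
Local Open Scope ring_scope.

(* Z(2)^omega is cantor_space, i.e. bool^nat with the product of the discrete
   topologies; the addition that MathComp puts on bool is exclusive or. *)
HB.instance Definition _ := GRing.Zmodule.copy cantor_space (nat -> bool).

Lemma cantor_sub_continuous :
  continuous (fun x : cantor_space * cantor_space => x.1 - x.2).
Proof.
move=> [a b]; apply/pointwise_cvgP => n.
have pn (c : cantor_space) : \forall d \near c, d n = c n.
  have /(_ c [set c n] (discrete_set1 (c n))) :=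
    @proj_continuous nat (fun=> bool) n.
  exact.
apply/discrete_cvg; exists ([set d | d n = a n], [set d | d n = b n]).
  by split; exact: pn.
by move=> [c d] [/= ca db]; rewrite !fctE ca db.
Qed.

HB.instance Definition _ :=
  PreTopologicalNmodule_isTopologicalZmodule.Build cantor_space
    cantor_sub_continuous.

Definition subgroup (X : topologicalZmodType) (G : zmodClosed X) :=
  {x : X | x \in G}.

Section subgroup.
Context (X : topologicalZmodType) (G : zmodClosed X).

HB.instance Definition _ := SubChoice.on (subgroup G).
HB.instance Definition _ := [SubChoice_isSubZmodule of subgroup G by <:].
HB.instance Definition _ :=
  Topological.copy (subgroup G) (initial_topology (val : subgroup G -> X)).

Lemma subgroup_sub_continuous :
  continuous (fun x : subgroup G * subgroup G => x.1 - x.2).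
Proof.
apply: (@continuous_comp_initial _ _ _ (val : subgroup G -> X)) => x.
have -> : val \o (fun x : subgroup G * subgroup G => x.1 - x.2) =
    (fun y : X * X => y.1 - y.2) \o (fun x => (val x.1, val x.2)).
  by apply/funext => y; exact: raddfB.
have cval := @initial_continuous (subgroup G) X val.
apply: continuous_comp; last exact: sub_continuous.
apply: cvg_pair; [apply: (cvg_comp _ _ cvg_fst) | apply: (cvg_comp _ _ cvg_snd)];
  exact: cval.
Qed.

HB.instance Definition _ :=
  PreTopologicalNmodule_isTopologicalZmodule.Build (subgroup G)
    subgroup_sub_continuous.
End subgroup.

Definition nowhere_dense (X : topologicalType) (A : set X) :=
  interior (closure A) = set0.

Definition first_category (X : topologicalType) :=
  exists F : (set X)^nat,
    (forall n, nowhere_dense (F n)) /\ \bigcup_n F n = [set: X].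

Definition cantor_borel := g_sigma_algebraType (@open cantor_space).
HB.instance Definition _ := Measurable.on cantor_borel.

(* cantor_space being compact and metrizable, regularity of a finite Borel
   measure is automatic: translation invariance characterizes Haar measure. *)
Definition haar (R : realType) (mu : probability cantor_borel R) :=
  forall (a : cantor_space) (A : set cantor_borel),
    measurable A -> mu [set a + x | x in (A : set cantor_space)] = mu A.

Definition circle (R : realType) : Type :=
  set_type [set z : R[i]^o | `|z| = 1].
HB.instance Definition _ (R : realType) := Topological.on (circle R).

Definition character (R : realType) (H : topologicalZmodType)
    (chi : H -> circle R) :=
  continuous chi /\
  forall x y, \val (chi (x + y)) = \val (chi x) * \val (chi y).

(* Set types carry the subspace topology, so that dual R H has the topology of
   pointwise convergence on H. *)
Definition dual (R : realType) (H : topologicalZmodType) : Type :=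
  set_type [set chi : {ptws H -> circle R} | @character R H chi].
HB.instance Definition _ (R : realType) (H : topologicalZmodType) :=
  Topological.on (dual R H).

Definition functionally_bounded (R : realType) (X : topologicalType)
    (B : set X) :=
  forall f : X -> R, continuous f -> bounded_set (f @` B).

Definition eventually_constant (X : Type) (u : X^nat) :=
  exists c, \forall n \near \oo, u n = c.

(* Main.v *)
Require Import Defs.
From HB Require Import structures.
From mathcomp Require Import all_boot all_order all_algebra complex zify.
From mathcomp Require Import all_classical all_reals all_analysis.
Import Order.TTheory GRing.Theory Num.Theory.
Import numFieldNormedType.Exports.
Local Open Scope classical_set_scope.
Local Open Scope ring_scope.

(** Elements of Z(2)^omega are read as subsets of nat, with symmetric difference
    as addition. The group G consists of the sets x for which the number of
    elements of x in the window [k, 2k) is bounded independently of k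
    ([sparse]). It is the union of the closed sets K_m ([window_bounded m])
    where this number is at most m.

    G is small because the window [k, 2k) is itself a member of G that is not in
    K_m once k > m, while K_m + K_m is contained in K_(m+m). On the one hand, x
    + [k, 2k) tends to x when k grows and leaves K_m, so K_m has empty interior
    in G ([first_category_sparse]). On the other hand, infinitely many
    translates of K_m, by windows that lie far from one another, are pairwise
    disjoint, so an invariant probability vanishes on K_m ([negligible_sparse]).

    G is large because it contains every set whose consecutive elements at least
    double ([lacunary_window_bounded]), and this defeats infinite bounded sets
    of characters. A character takes its values in {1, -1} and depends on
    finitely many coordinates only; those that depend on the first N coordinates
    are finite in number. An infinite set B of characters therefore contains
    characters chi_k with last relevant coordinates n_k such that n_(k+1) >= 2
    n_k ([leading_coordinate]). All subsets of {n_0, n_1, ...} are in G, so the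
    values of the chi_k can be prescribed one after the other: for each j there
    is y_j in G, vanishing below n_j, with chi_k(y_j) = -1 for all k >= j
    ([interpolation]). Every character psi satisfies psi(y_j) = 1 for large j,
    so the least such j is defined; it is a locally constant function of psi,
    and it exceeds k at chi_k. Hence B is not bounded ([bounded_finite]).

    The range of a convergent sequence of characters is bounded, hence finite,
    and in a T1 space a convergent sequence of finite range is eventually
    constant. *)

(** * Sets with boundedly many elements in every window *)

Definition window (k : nat) : cantor_space := fun i => (k <= i < k.*2)%N.

Definition window_bounded (m : nat) : set cantor_space :=
  [set x | forall k, (count (x : nat -> bool) (iota k k) <= m)%N].

Definition unit_vector (n : nat) : cantor_space := fun i => i == n.

Lemma cantor_addE (x y : cantor_space) i : (x + y) i = x i (+) y i.
Proof. by []. Qed.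

Lemma cantor_oppE (x : cantor_space) : - x = x.
Proof. by []. Qed.

Lemma cantor_addxx (x : cantor_space) : x + x = 0.
Proof. by rewrite -[X in X + _]cantor_oppE addNr. Qed.

Lemma window_bounded0 : window_bounded 0 0.
Proof. by move=> k; rewrite (@eq_count _ _ pred0) ?count_pred0. Qed.

Lemma window_boundedD m n x y :
  window_bounded m x -> window_bounded n y -> window_bounded (m + n) (x + y).
Proof.
move=> xm yn k; apply: leq_trans (leq_add (xm k) (yn k)).
rewrite -count_predUI; apply: leq_trans (leq_addr _ _).
by apply: sub_count => i /=; rewrite cantor_addE; case: (x i); case: (y i).
Qed.

(** Two elements of one window [k, 2k) are less than a factor 2 apart. *)
Lemma lacunary_window_bounded (x : cantor_space) :
  (forall a b, x a -> x b -> (a < b)%N -> (a.*2 <= b)%N) -> window_bounded 1 x.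
Proof.
move=> xlac k; rewrite -size_filter.
have: sorted ltn [seq i <- iota k k | x i].
  by apply: sorted_filter; [exact: ltn_trans | exact: iota_ltn_sorted].
have: all (fun i => x i && (k <= i < k + k)%N) [seq i <- iota k k | x i].
  by apply/allP => i; rewrite mem_filter mem_iota.
case: [seq _ <- _ | _] => [|a [|b s]] //=.
by move=> /and3P[/andP[xa ak] /andP[xb bk] _] /andP[/(xlac _ _ xa xb)]; lia.
Qed.

Lemma unit_vector_window_bounded n : window_bounded 1 (unit_vector n).
Proof. by apply: lacunary_window_bounded => a b /eqP-> /eqP->; lia. Qed.

Lemma window_window_bounded k : window_bounded k (window k).
Proof.
move=> j; rewrite -size_filter -[X in (_ <= X)%N](size_iota k k).
apply: uniq_leq_size; first by rewrite filter_uniq ?iota_uniq.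
by move=> i; rewrite mem_filter !mem_iota /window; lia.
Qed.

Lemma count_window_self k : count (window k : nat -> bool) (iota k k) = k.
Proof.
rewrite -[RHS](size_iota k k); apply/eqP; rewrite -all_count; apply/allP => i.
by rewrite mem_iota /window; lia.
Qed.

Lemma window_unbounded m k : window_bounded m (window k) -> (k <= m)%N.
Proof. by move=> /(_ k); rewrite count_window_self. Qed.

(** The second window misses the first one, so that the sum still contains all
    the j elements of the first window. *)
Lemma two_windows_unbounded m j k : (j.*2 <= k)%N || (k.*2 <= j)%N ->
  window_bounded m (window j + window k) -> (j <= m)%N.
Proof.
move=> jk /(_ j); rewrite (@eq_in_count _ _ (window j : nat -> bool)).
  by rewrite count_window_self.
move=> i; rewrite mem_iota cantor_addE /window => ij.
have -> : (k <= i < k.*2)%N = false by lia.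
by rewrite addbF.
Qed.

(** * Topology of the Cantor group *)

Lemma near_agree (x : cantor_space) N :
  \forall y \near x, forall i, (i < N)%N -> y i = x i.
Proof.
elim: N => [|N IH]; first by near=> y.
have xN : \forall y \near x, y N = x N.
  have /(_ x [set x N] (discrete_set1 (x N))) :=
    @proj_continuous nat (fun=> bool) N.
  exact.
near=> y => i; rewrite ltnS leq_eqVlt => /orP[/eqP ->|iN].
  by near: y.
by move: i iN; near: y.
Unshelve. all: by end_near. Qed.

Lemma translation_continuous (a : cantor_space) :
  continuous (fun y : cantor_space => y - a).
Proof.
move=> y; apply/pointwise_cvgP => n; apply/discrete_cvg.
by apply: filterS (near_agree y n.+1) => z zy; rewrite /= !cantor_addE zy.
Qed.

(** Each of the defining conditions reads finitely many coordinates. *)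
Lemma closed_window_bounded m : closed (window_bounded m).
Proof.
move=> x clx k; have [y [ym yx]] := clx _ (near_agree x (k + k)).
apply: leq_trans (ym k); rewrite leq_eqVlt; apply/orP; left; apply/eqP.
by apply: eq_in_count => i; rewrite mem_iota => /andP[_ /yx].
Qed.

(** * The group of sparse sets *)

Definition sparse : {pred cantor_space} :=
  fun x => `[< exists m, window_bounded m x >].

Lemma sparseP (x : cantor_space) :
  reflect (exists m, window_bounded m x) (x \in sparse).
Proof. exact: asboolP. Qed.

Lemma sparse_zmod_closed : zmod_closed sparse.
Proof.
split=> [|x y /sparseP[m xm] /sparseP[n yn]]; apply/sparseP.
  by exists 0; exact: window_bounded0.
by exists (m + n)%N; rewrite cantor_oppE; exact: window_boundedD.
Qed.

HB.instance Definition _ :=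
  GRing.isZmodClosed.Build cantor_space sparse sparse_zmod_closed.

(** * First category and measure zero *)

Lemma agree_cvg (G : zmodClosed cantor_space) (u : nat -> subgroup G)
    (x : subgroup G) :
  (forall k i, (i < k)%N -> val (u k) i = val x i) -> u @ \oo --> x.
Proof.
move=> ux A [_ [[B Bop <-] Bx] BA].
have /(_ B) : (fun k => val (u k) : cantor_space) @ \oo -->
    (val x : cantor_space).
  apply/pointwise_cvgP => i; apply/discrete_cvg.
  by exists i.+1 => // k /= ik; exact: ux.
have xB : nbhs (val x : cantor_space) B by exact: open_nbhs_nbhs.
by move=> /(_ xB)[N _ NB]; exists N => // k Nk; apply: BA; exact: NB.
Qed.

Lemma window_sparse k : window k \in sparse.
Proof. by apply/sparseP; exists k; exact: window_window_bounded. Qed.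

Lemma unit_vector_sparse k : unit_vector k \in sparse.
Proof. by apply/sparseP; exists 1; exact: unit_vector_window_bounded. Qed.

Lemma unit_vector_inj : injective unit_vector.
Proof.
by move=> m n /(congr1 (@^~ m)); rewrite /unit_vector eqxx => /esym/eqP.
Qed.

Lemma infinite_sparse : infinite_set [set` sparse].
Proof.
apply: (@sub_infinite_set _ (range unit_vector)).
  by move=> _ [k _ <-]; exact: unit_vector_sparse.
rewrite (eq_finite_set (inj_card_eq (in2W unit_vector_inj))).
exact: infinite_nat.
Qed.

(** Adding a late window to x changes x as little as desired, but brings it out
    of [window_bounded m] as soon as the window has more than m + m elements. *)
Lemma first_category_sparse : first_category (subgroup sparse).
Proof.
exists (fun m => val @^-1` window_bounded m); split; last first.
  apply/seteqP; split=> // x _; have /sparseP[m xm] := valP x.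
  by exists m.
move=> m; apply/seteqP; split=> // x.
have /closure_id <- :
    closed (val @^-1` window_bounded m : set (subgroup sparse)).
  apply: closed_comp; last exact: closed_window_bounded.
  by move=> y _; exact: initial_continuous.
pose w k : subgroup sparse := exist _ (window k) (window_sparse k).
move=> intx; have : (fun k => x + w k) @ \oo --> x.
  apply: agree_cvg => k i ik; rewrite raddfD /= cantor_addE /window.
  by rewrite leqNgt ik addbF.
move=> /(_ _ intx)[N _ /(_ (maxn N (m + m).+1) (leq_maxl _ _))] xwm.
have xm : window_bounded m (val x) by exact: (interior_subset intx).
(* The window is the sum of x and x + window, both in K_m. *)
have := window_boundedD _ _ _ (val x + window _) xm xwm.
rewrite addrA cantor_addxx add0r => /window_unbounded; lia.
Qed.

(** The translates all have the measure of K, and n of them fit into a space of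
    measure 1. *)
Lemma null_of_disjoint_translates (R : realType)
    (mu : probability cantor_borel R) (K : set cantor_space)
    (a : nat -> cantor_space) :
  haar mu -> closed K ->
  (forall i j x y, i != j -> K x -> K y -> a i + x <> a j + y) ->
  measurable (K : set cantor_borel) /\ mu K = 0%E.
Proof.
move=> mu_haar Kcl dis.
have closed_measurable (A : set cantor_space) :
    closed A -> measurable (A : set cantor_borel).
  move=> Acl; rewrite -[A]setCK; apply: measurableC.
  by apply: sub_gen_smallest; exact: closed_openC.
have mK := closed_measurable _ Kcl; split => //.
pose F i : set cantor_borel := [set a i + x | x in K].
have mF i : measurable (F i).
  apply: closed_measurable.
  have -> : F i = (fun y : cantor_space => y - a i) @^-1` K.
    apply/seteqP; split=> [_ [x Kx <-]|y Ky] /=; first by rewrite addrC addKr.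
    by exists (y - a i) => //; rewrite addrC subrK.
  apply: closed_comp; last exact: Kcl.
  by move=> y _; exact: translation_continuous.
have tF : trivIset setT F.
  move=> i j _ _ [_ [[x Kx <-] [y Ky xy]]].
  have [//|ij] := eqVneq i j.
  by have := dis i j x y ij Kx Ky (esym xy).
have mule1 n : fine (mu K) *+ n <= 1.
  have /(probability_le1 mu) : measurable (\big[setU/set0]_(i < n) F i).
    by apply: bigsetU_measurable => i _; exact: mF.
  rewrite measure_bigsetU//.
  have -> : (\sum_(i < n) mu (F i))%E = (\sum_(i < n) (fine (mu K))%:E)%E.
    by apply: eq_bigr => i _; rewrite fineK ?fin_num_measure//; exact: mu_haar.
  by rewrite sumEFin lee_fin sumr_const card_ord.
apply/eqP; rewrite -measure_le0 -(fineK (fin_num_measure mu K mK)) lee_fin.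
rewrite leNgt; apply/negP => c0.
have := archi_boundP (ltW (divr_gt0 ltr01 c0)).
rewrite ltNge => /negP; apply.
by rewrite ler_pdivlMr// mulrC mulr_natr.
Qed.

Lemma negligible_sparse (R : realType) (mu : probability cantor_borel R) :
  haar mu -> mu.-negligible [set` sparse].
Proof.
move=> mu_haar; apply: (@negligibleS _ _ _ mu (\bigcup_m window_bounded m)).
  by move=> x /= /sparseP[m xm]; exists m.
apply: negligible_bigcup => m.
(* Each of the translating windows has more than m + m elements, and each starts
   after the end of the previous ones. *)
pose k i := ((m + m).+1 * 2 ^ i)%N.
have [] := @null_of_disjoint_translates R mu (window_bounded m)
  (fun i => window (k i)) mu_haar (closed_window_bounded m); last first.
  by move=> mK K0; exact/negligibleP.
move=> i j x y ij xm ym /= xy.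
have k_sep a b : (a < b)%N -> ((k a).*2 <= k b)%N.
  move=> ab; rewrite /k -muln2 -mulnA leq_mul2l /= -expnSr leq_exp2l//.
have sum : window_bounded (m + m) (window (k i) + window (k j)).
  rewrite (_ : _ + _ = x + y); first exact: window_boundedD.
  have -> : y = window (k j) + (window (k i) + x).
    by rewrite xy addrA cantor_addxx add0r.
  by rewrite addrC [X in _ = X]addrC -!addrA cantor_addxx addr0.
have sep : ((k i).*2 <= k j)%N || ((k j).*2 <= k i)%N.
  by case: (ltngtP i j) ij => // [/k_sep ->|/k_sep ->]; rewrite ?orbT.
have := two_windows_unbounded _ _ _ sep sum.
rewrite /k leqNgt => /negP; apply.
by rewrite leq_pmulr ?expn_gt0.
Qed.

(** * Characters of a topological group of exponent two *)

Section dual.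
Context {R : realType} {H : topologicalZmodType}.
Implicit Types (chi : dual R H) (x y : H).

Definition dual_val chi x : R[i] := \val (val chi x).

Lemma dual_valD chi x y :
  dual_val chi (x + y) = dual_val chi x * dual_val chi y.
Proof. by have /set_mem[_] := valP chi; exact. Qed.

Lemma norm_dual_val chi x : `|dual_val chi x| = 1.
Proof. exact: (set_mem (valP (val chi x))). Qed.

Lemma dual_val_neq0 chi x : dual_val chi x != 0.
Proof. by rewrite -normr_gt0 norm_dual_val. Qed.

Lemma dual_val0 chi : dual_val chi 0 = 1.
Proof.
by apply: (mulfI (dual_val_neq0 chi 0)); rewrite -dual_valD addr0 mulr1.
Qed.

Lemma dual_val_eq chi psi :
  (forall x, dual_val chi x = dual_val psi x) -> chi = psi.
Proof.
move=> e; apply: val_inj; apply/funext => x; apply: val_inj; exact: e.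
Qed.

Lemma dual_val_continuous chi : continuous (dual_val chi : H -> R[i]^o).
Proof.
move=> x; have /set_mem[c _] := valP chi.
have c3 := @initial_continuous (circle R) R[i]^o val (val chi x).
exact: (cvg_comp _ _ (c x) c3).
Qed.

Lemma eval_dual_continuous x : continuous (fun chi => dual_val chi x : R[i]^o).
Proof.
move=> chi.
have c1 := @initial_continuous (dual R H) {ptws H -> circle R} val chi.
have c2 := @proj_continuous H (fun=> circle R) x (val chi).
have c3 := @initial_continuous (circle R) R[i]^o val (val chi x).
exact: (cvg_comp _ _ (cvg_comp _ _ c1 c2) c3).
Qed.

Context (exponent2 : forall x : H, x + x = 0).

Lemma dual_val_sign chi x : dual_val chi x = 1 \/ dual_val chi x = -1.
Proof.
have /eqP := dual_valD chi x x.
rewrite exponent2 dual_val0 eq_sym -expr2 sqrf_eq1.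
by move=> /orP[/eqP|/eqP]; [left|right].
Qed.

Lemma sign_near_eq (c z : R[i]) :
  c = 1 \/ c = -1 -> z = 1 \/ z = -1 -> `|c - z| < 1 -> z = c.
Proof.
have n2 : (`|1 + 1 : R[i]| < 1) = false by rewrite ger0_norm// gtrDl ltr10.
case=> -> [] -> //; first by rewrite opprK n2.
by rewrite -normrN opprD opprK n2.
Qed.

(** Since the values of characters are signs, evaluation at x is locally
    constant on the dual. *)
Lemma open_eval_eq x (c : R[i]) :
  c = 1 \/ c = -1 -> open [set chi | dual_val chi x = c].
Proof.
move=> csign.
have -> : [set chi | dual_val chi x = c] =
    (fun chi => dual_val chi x : R[i]^o) @^-1` ball (c : R[i]^o) 1.
  apply/seteqP; split=> chi /=.
    by move=> ->; exact: ballxx.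
  by rewrite -ball_normE /=; apply: sign_near_eq => //; exact: dual_val_sign.
apply: open_comp; first by move=> chi _; exact: eval_dual_continuous.
exact: ball_open.
Qed.

Lemma near0_dual_val chi : nbhs (0 : H) [set x | dual_val chi x = 1].
Proof.
apply: open_nbhs_nbhs; split; last exact: dual_val0.
have -> : [set x | dual_val chi x = 1] =
    (dual_val chi : H -> R[i]^o) @^-1` ball (1 : R[i]^o) 1.
  apply/seteqP; split=> x /=; first by move=> ->; exact: ballxx.
  rewrite -ball_normE /=.
  by apply: sign_near_eq; [left | exact: dual_val_sign].
apply: open_comp; first by move=> x _; exact: dual_val_continuous.
exact: ball_open.
Qed.

Lemma accessible_dual : accessible_space (dual R H).
Proof.
move=> chi psi /eqP chi_psi.
have [x chix] : exists x, dual_val chi x != dual_val psi x.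
  apply: contrapT => /forallNP e; apply: chi_psi; apply: dual_val_eq => x.
  by have /negP/negPn/eqP := e x.
exists [set phi | dual_val phi x = dual_val chi x]; split.
- exact/open_eval_eq/dual_val_sign.
- by rewrite inE.
- by rewrite inE /=; apply/eqP; rewrite eq_sym.
Qed.
End dual.

(** * Two general facts on topological spaces *)

Lemma locally_constant_continuous (X Y : topologicalType) (f : X -> Y) :
  (forall x, \forall y \near x, f y = f x) -> continuous f.
Proof. by move=> fx x; exact: cvg_near_cst (fx x). Qed.

Lemma finite_range_eventually_constant (X : topologicalType) (u : X^nat)
    (x : X) :
  accessible_space X -> finite_set (range u) -> u @ \oo --> x ->
  eventually_constant u.
Proof.
move=> /accessible_finite_set_closed fin_closed finu ux; exists x.
have nx : nbhs x (~` (range u `\ x)).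
  apply: open_nbhs_nbhs; split; last by move=> [_]; exact.
  by apply: closed_openC; apply: fin_closed; exact: finite_setD.
have [N _ NP] := ux _ nx; exists N => // k Nk; apply: contrapT => ukx.
by apply: (NP _ Nk); split => //; exists k.
Qed.

(** * Characters of the group of sparse sets *)

Section characters.
Context {R : realType}.
Local Notation G := (subgroup sparse).
Local Notation D := (dual R G).
Implicit Types (chi psi : D) (x y : G).

Lemma subgroup_addxx x : x + x = 0.
Proof. by apply: val_inj; rewrite raddfD raddf0; exact: cantor_addxx. Qed.

Definition unit_elt k : G := exist _ (unit_vector k) (unit_vector_sparse k).

Definition vanish_below (N : nat) x := forall i, (i < N)%N -> val x i = false.

Definition trivial_past (N : nat) chi :=
  forall x, vanish_below N x -> dual_val chi x = 1.

(** Otherwise there would be points converging to 0 at which chi is not 1,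
    contradicting that the values of chi are signs and that chi is
    continuous. *)
Lemma trivial_past_ex chi : exists N, trivial_past N chi.
Proof.
apply: contrapT => /forallNP notriv.
have /choice[u u_def] : forall N,
    exists x, vanish_below N x /\ dual_val chi x <> 1.
  move=> N; apply: contrapT => /forallNP h; apply: (notriv N) => x x0.
  by apply: contrapT => chix; exact: (h x).
have u0 : u @ \oo --> (0 : G).
  by apply: agree_cvg => k i ik; rewrite (u_def k).1.
have [N _ /(_ N (leqnn N)) uN] := u0 _ (near0_dual_val subgroup_addxx chi).
by have [_] := u_def N.
Qed.

Lemma trivial_pastW M N chi :
  (M <= N)%N -> trivial_past M chi -> trivial_past N chi.
Proof.
by move=> MN chiM x xN; apply: chiM => i iM; apply: xN; exact: leq_trans MN.
Qed.

Lemma vanish_below_split k x : vanish_below k x ->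
  vanish_below k.+1 x \/ exists2 y, vanish_below k.+1 y & x = y + unit_elt k.
Proof.
move=> xk; case xkE: (val x k); last first.
  by left=> i; rewrite ltnS leq_eqVlt => /orP[/eqP-> //|/xk].
right; exists (x + unit_elt k); last by rewrite -addrA subgroup_addxx addr0.
move=> i; rewrite ltnS leq_eqVlt raddfD cantor_addE /= /unit_vector.
by case/orP => [/eqP ->|ik]; rewrite ?xkE ?eqxx// xk// (ltn_eqF ik).
Qed.

(** An element is the sum of the unit vectors of its coordinates below N and of
    an element vanishing below N; the induction removes these unit vectors one
    by one. *)
Lemma trivial_past_inj N chi psi : trivial_past N chi -> trivial_past N psi ->
  (forall i, (i < N)%N ->
    dual_val chi (unit_elt i) = dual_val psi (unit_elt i)) ->
  chi = psi.
Proof.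
move=> chiN psiN e; apply: dual_val_eq => x.
suff /(_ N x) : forall d y, vanish_below (N - d) y ->
    dual_val chi y = dual_val psi y.
  by apply=> i; rewrite subnn.
elim=> [y|d IH y yd]; first by rewrite subn0 => yN; rewrite chiN// psiN.
have [Nd|dN] := leqP N d.
  by apply: IH => i; rewrite (eqP Nd).
have Nd : (N - d = (N - d.+1).+1)%N by lia.
rewrite Nd in IH; have [/IH//|[z /IH zE ->]] := vanish_below_split _ _ yd.
by rewrite !dual_valD zE e//; lia.
Qed.

Lemma trivial_past_finite N : finite_set [set chi | trivial_past N chi].
Proof.
pose f chi := [ffun i : 'I_N => dual_val chi (unit_elt i) == 1].
have finj : {in [set chi | trivial_past N chi] &, injective f}.
  move=> chi psi /set_mem chiN /set_mem psiN /ffunP fE.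
  apply: (trivial_past_inj N) => // i iN.
  have := fE (Ordinal iN); rewrite !ffunE /=.
  have [->|->] := dual_val_sign subgroup_addxx chi (unit_elt i);
  by have [->|->] := dual_val_sign subgroup_addxx psi (unit_elt i);
    rewrite ?eqxx ?eqNr ?oner_eq0.
by rewrite -(eq_finite_set (inj_card_eq finj)); exact: finite_finset.
Qed.

(** The witness n is the last coordinate on which chi depends: if chi were 1 at
    the n-th unit vector, then it would already be trivial past n. *)
Lemma leading_coordinate (B : set D) N : infinite_set B ->
  exists chi n, [/\ B chi, (N <= n)%N, dual_val chi (unit_elt n) = -1 &
    trivial_past n.+1 chi].
Proof.
move=> Binf.
have [chi [Bchi chiN]] : exists chi, B chi /\ ~ trivial_past N chi.
  apply: contrapT => /forallNP h; apply: Binf.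
  apply: sub_finite_set (trivial_past_finite N) => chi Bchi /=.
  by apply: contrapT => ?; exact: (h chi).
have exM : exists M, `[< trivial_past M chi >].
  by have [M chiM] := trivial_past_ex chi; exists M; exact/asboolP.
have [M /asboolP chiM Mmin] := ex_minnP exM.
have NM : (N < M)%N.
  by rewrite ltnNge; apply/negP => /trivial_pastW/(_ chiM).
case: M NM => // n Nn in chiM Mmin *; exists chi, n; split => //.
have [chi1|//] := dual_val_sign subgroup_addxx chi (unit_elt n).
suff /asboolP/Mmin : trivial_past n chi by rewrite ltnn.
move=> x /vanish_below_split[/chiM//|[y /chiM yE ->]].
by rewrite dual_valD yE chi1 mulr1.
Qed.

(** ** Prescribing the values of characters with sparse leading coordinates *)

Section interpolation.
Context (chi : nat -> D) (n : nat -> nat) (j : nat).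
Context (n_pos : (0 < n 0)%N) (n_double : forall k, ((n k).*2 <= n k.+1)%N).
Context (chi_lead : forall k, dual_val (chi k) (unit_elt (n k)) = -1).
Context (chi_past : forall k, trivial_past (n k).+1 (chi k)).

(** The k-th step decides whether n_k belongs to the set under construction: it
    is put in exactly when this is needed to give chi_k the value -1. Later
    steps only touch coordinates on which chi_k does not depend. *)
Fixpoint approximant k : G :=
  if k is k'.+1 then
    let z := approximant k' in
    if (k' < j)%N || (dual_val (chi k') z == -1) then z
    else z + unit_elt (n k')
  else 0.

Lemma leading_gt k : (k < n k)%N.
Proof. by elim: k => // k; have := n_double k; lia. Qed.

Lemma leading_double k l : (k < l)%N -> ((n k).*2 <= n l)%N.
Proof.
elim: l => // l IH; rewrite ltnS leq_eqVlt => /orP[/eqP ->//|/IH].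
by have := n_double l; lia.
Qed.

Lemma leading_mono k l : (n k < n l)%N -> (k < l)%N.
Proof.
move=> nkl; have [//|] := ltnP k l.
rewrite leq_eqVlt => /orP[/eqP lk|/leading_double]; last lia.
by rewrite lk ltnn in nkl.
Qed.

Lemma approximantS k i : i <> n k ->
  val (approximant k.+1) i = val (approximant k) i.
Proof.
move=> ik; rewrite [approximant k.+1]/=; case: ifP => // _.
rewrite raddfD cantor_addE /= /unit_vector.
by move/eqP/negbTE: ik ->; rewrite addbF.
Qed.

Lemma approximant_support k i : val (approximant k) i ->
  exists2 l, (j <= l)%N & i = n l.
Proof.
elim: k => [//|k IH]; have [ik|ik] := eqVneq i (n k); last first.
  by rewrite approximantS //; exact/eqP.
have [jk|kj] := leqP j k; first by exists k.
by rewrite /= kj.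
Qed.

Lemma approximant_stable a b i : (a <= b)%N ->
  (forall l, (a <= l)%N -> i <> n l) ->
  val (approximant b) i = val (approximant a) i.
Proof.
move=> ab h; elim: b ab => [|b IH]; first by rewrite leqn0 => /eqP ->.
rewrite leq_eqVlt => /orP[/eqP -> //|]; rewrite ltnS => ab.
by rewrite approximantS ?IH//; exact: h.
Qed.

Lemma approximant_value k : (j <= k)%N ->
  dual_val (chi k) (approximant k.+1) = -1.
Proof.
move=> jk /=; rewrite ltnNge jk /=; case: eqP => // zN.
have [z1|//] := dual_val_sign subgroup_addxx (chi k) (approximant k).
by rewrite dual_valD z1 chi_lead mul1r.
Qed.

(** Coordinate i is settled after step i because n_k > k. *)
Definition interpolant : cantor_space := fun i => val (approximant i.+1) i.

Lemma interpolant_agree k i : (i <= n k)%N ->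
  interpolant i = val (approximant k.+1) i.
Proof.
move=> ik; pose m := maxn i.+1 k.+1; rewrite /interpolant.
rewrite -(@approximant_stable i.+1 m) ?leq_maxl//; last first.
  by move=> l il; have := leading_gt l; lia.
rewrite -(@approximant_stable k.+1 m) ?leq_maxr// => l kl.
by have := leading_double _ _ kl; have := leading_gt k; lia.
Qed.

(** The support consists of some of the n_k, which at least double. *)
Lemma interpolant_sparse : interpolant \in sparse.
Proof.
apply/sparseP; exists 1; apply: lacunary_window_bounded => a b.
move=> /approximant_support[k _ ->] /approximant_support[l _ ->].
by move=> /leading_mono/leading_double.
Qed.

Lemma interpolation : exists y, vanish_below (n j) y /\
  forall k, (j <= k)%N -> dual_val (chi k) y = -1.
Proof.
pose y : G := exist _ interpolant interpolant_sparse; exists y; split.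
  move=> i ij; case yi: (val y i) => //.
  have [l jl il] := approximant_support _ _ yi.
  move: ij; rewrite il ltnNge => /negP[].
  move: jl; rewrite leq_eqVlt => /orP[/eqP -> //|/leading_double]; lia.
move=> k jk; rewrite -(approximant_value _ jk).
rewrite -[in LHS](subrK (approximant k.+1) y) dual_valD chi_past ?mul1r// => i.
rewrite ltnS => ik.
have -> : val (y - approximant k.+1) i = val y i (+) val (approximant k.+1) i.
  by rewrite raddfB.
have -> : val y i = val (approximant k.+1) i by exact: interpolant_agree.
by rewrite addbb.
Qed.
End interpolation.

(** On an infinite set of characters, the least j with psi(y_j) = 1 is
    unbounded, where y_j is the element given by [interpolation]. *)
Lemma bounded_finite (B : set D) : functionally_bounded R B -> finite_set B.
Proof.
move=> Bbd; apply: contrapT => Binf.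
have /choice[lead leadP] : forall N, exists p : D * nat,
    [/\ B p.1, (N <= p.2)%N, dual_val p.1 (unit_elt p.2) = -1 &
      trivial_past p.2.+1 p.1].
  by move=> N; have [chi [n ?]] := leading_coordinate B N Binf; exists (chi, n).
(* Asking for a leading coordinate of at least twice the previous one ensures
   that the set of all of them is lacunary; starting from 1 makes them positive,
   so that doubling is strict. *)
pose s := fix s k := if k is k'.+1 then lead (s k').2.*2 else lead 1.
pose chi k := (s k).1; pose n k := (s k).2.
have sP k : exists N, s k = lead N by case: k => [|k]; eexists.
have chiB k : B (chi k).
  by rewrite /chi; have [N ->] := sP k; have [] := leadP N.
have n0 : (0 < n 0)%N by have [] := leadP 1.
have nS k : ((n k).*2 <= n k.+1)%N by have [] := leadP (n k).*2.
have chi_lead k : dual_val (chi k) (unit_elt (n k)) = -1.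
  by rewrite /chi /n; have [N ->] := sP k; have [] := leadP N.
have chi_past k : trivial_past (n k).+1 (chi k).
  by rewrite /chi /n; have [N ->] := sP k; have [] := leadP N.
have /choice[y yP] := fun j => interpolation chi n j n0 nS chi_lead chi_past.
have ex_j psi : exists j, dual_val psi (y j) == 1.
  have [N psiN] := trivial_past_ex psi; exists N.
  apply/eqP; apply: psiN => i iN.
  by apply: (yP N).1; apply: ltn_trans iN _; exact: leading_gt n0 nS _.
pose first psi := ex_minn (ex_j psi).
have first_agree phi psi : (forall i, (i <= first psi)%N ->
    dual_val phi (y i) = dual_val psi (y i)) -> first phi = first psi.
  rewrite /first; case: ex_minnP => a psia amin agree.
  case: ex_minnP => b phib bmin; apply/eqP; rewrite eqn_leq; apply/andP; split.
    by apply: bmin; rewrite agree.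
  rewrite leqNgt; apply/negP => ba.
  by have := amin b; rewrite -agree ?(ltnW ba)// leqNgt ba => /(_ phib).
have near_agree_at psi N : \forall phi \near psi, forall i, (i <= N)%N ->
    dual_val phi (y i) = dual_val psi (y i).
  have near1 i : \forall phi \near psi, dual_val phi (y i) = dual_val psi (y i).
    apply: open_nbhs_nbhs; split => //.
    exact/open_eval_eq/dual_val_sign/subgroup_addxx/subgroup_addxx.
  elim: N => [|N IH].
    by apply: filterS (near1 0) => phi phi0 i; rewrite leqn0 => /eqP ->.
  apply: filterS2 IH (near1 N.+1) => phi phiN phiN1 i.
  by rewrite leq_eqVlt ltnS => /orP[/eqP ->|/phiN].
have first_cont : continuous (fun psi => (first psi)%:R : R).
  apply: locally_constant_continuous => psi.
  apply: filterS (near_agree_at psi (first psi)) => phi agree.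
  by rewrite (first_agree _ _ agree).
have [M [_ /(_ (M + 1))]] := Bbd _ first_cont.
rewrite ltrDl ltr01 => /(_ isT) Mbd.
have first_chi k : (k < first (chi k))%N.
  rewrite /first; case: ex_minnP => m /eqP m1 _.
  rewrite ltnNge; apply/negP => mk.
  by have /eqP := (yP m).2 k mk; rewrite m1 eq_sym eqNr oner_eq0.
have le_first k : (first (chi k))%:R <= M + 1.
  have := Mbd (first (chi k))%:R; rewrite /= normr_nat; apply.
  by exists (chi k).
have := archi_boundP (le_trans (ler0n R _) (le_first 0)).
rewrite ltNge => /negP; apply; apply: le_trans (le_first (Num.bound (M + 1))).
by rewrite ler_nat ltnW.
Qed.
End characters.

Lemma functionally_bounded_cvg_range (R : realType) (X : topologicalType)
    (u : X^nat) (x : X) :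
  u @ \oo --> x -> functionally_bounded R (range u).
Proof.
move=> ux f fcont.
have : cvg ((f \o u : R^nat) @ \oo).
  by apply/cvg_ex; exists (f x); exact: (cvg_comp _ _ ux (fcont x)).
move=> /cvg_seq_bounded; rewrite /bounded_fun /bounded_set image_comp.
move=> [M [Mreal Mbd]]; exists M; split=> // t /Mbd fu_le _ [n _ <-].
exact: fu_le.
Qed.

Theorem theorem2p3 (R : realType) (mu : probability cantor_borel R)
    (mu_haar : haar mu) :
  exists G : zmodClosed cantor_space,
    [/\ infinite_set [set` G],
        first_category (subgroup G),
        mu.-negligible [set` G],
        forall B : set (dual R (subgroup G)),
          functionally_bounded R B -> finite_set B
      & forall (u : (dual R (subgroup G))^nat) (chi : dual R (subgroup G)),
          u @ \oo --> chi -> eventually_constant u].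
Proof.
exists (sparse : zmodClosed cantor_space); split.
- exact: infinite_sparse.
- exact: first_category_sparse.
- exact: negligible_sparse.
- exact: bounded_finite.
- move=> u chi u_chi.
  apply: (finite_range_eventually_constant _ _ chi _ _ u_chi).
    exact: accessible_dual subgroup_addxx.
  exact/bounded_finite/(functionally_bounded_cvg_range _ _ _ _ u_chi).
Qed.
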